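(* The complete bipartite graph $K_{3,3}$ and the triangular prism (two disjoint triangles $a_1a_2a_3$ and $b_1b_2b_3$ together with the edges $a_ib_i$, $i=1,2,3$) are 3-balanced, so that all connected cubic graphs on 6 vertices are 3-balanced.
   Context: A graph is 3-balanced if it admits a vertex coloring $\ell:V\to\mathbb{Z}_3$ such that every vertex has, in its open neighborhood, the same number of vertices of each of the three colors. *)

(* Defs.v *)
From HB Require Import structures.
From mathcomp Require Import all_boot all_order all_algebra.

Set Implicit Arguments.
Unset Strict Implicit.
Unset Printing Implicit Defensive.

Record sgraph := SGraph {
  vertex :> finType;
  adj : rel vertex;
  adj_sym : symmetric adj;
  adj_irrefl : irreflexive adj }.

Definition open_nbhd (G : sgraph) (v : G) : {set G} := [set w | adj v w].

Definition cubic (G : sgraph) : Prop := forall v : G, #|open_nbhd v| = 3.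

Definition connected_graph (G : sgraph) : Prop :=
  0 < #|G| /\ forall u v : G, connect (@adj G) u v.

Definition three_balanced (G : sgraph) : Prop :=
  exists l : G -> 'Z_3, forall (v : G) (c d : 'Z_3),
    #|[set w in open_nbhd v | l w == c]| = #|[set w in open_nbhd v | l w == d]|.

Definition biclique_adj (m n : nat) : rel ('I_m + 'I_n) := fun u v =>
  match u, v with
  | inl _, inr _ | inr _, inl _ => true
  | inl _, inl _ | inr _, inr _ => false
  end.

Lemma biclique_adj_sym m n : symmetric (@biclique_adj m n).
Proof. by move=> [i|i] [j|j]. Qed.

Lemma biclique_adj_irrefl m n : irreflexive (@biclique_adj m n).
Proof. by move=> [i|i]. Qed.

Definition complete_bipartite (m n : nat) : sgraph :=
  SGraph (@biclique_adj_sym m n) (@biclique_adj_irrefl m n).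

(* [inl i] is the vertex a_(i+1) and [inr i] is the vertex b_(i+1). *)
Definition prism_adj : rel ('I_3 + 'I_3) := fun u v =>
  match u, v with
  | inl i, inl j | inr i, inr j => i != j
  | inl i, inr j | inr i, inl j => i == j
  end.

Lemma prism_adj_sym : symmetric prism_adj.
Proof. by move=> [i|i] [j|j] /=; rewrite eq_sym. Qed.

Lemma prism_adj_irrefl : irreflexive prism_adj.
Proof. by move=> [i|i] /=; rewrite eqxx. Qed.

Definition triangular_prism : sgraph := SGraph prism_adj_sym prism_adj_irrefl.

(* Main.v *)
(** A cubic graph on six vertices is 3-balanced as soon as its vertices can be
    split into three pairs such that every vertex is adjacent to exactly one
    member of each pair.  In the prism and in [K_(3,3)] the pairs
    [{a_i, b_i}] work.  For an arbitrary cubic graph on six vertices the 15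
    possible adjacencies are treated as Boolean unknowns; the degree conditions
    leave 70 labelled graphs, and for each of them a suitable pairing is found
    by evaluation. *)
Require Import Defs.
From HB Require Import structures.
From mathcomp Require Import all_boot all_order all_algebra.

Set Implicit Arguments.
Unset Strict Implicit.
Unset Printing Implicit Defensive.

(** With degree 3, balance means that each color occurs exactly once, hence the count 1. *)
Definition balanced_row (r : seq bool) (l : seq 'Z_3) : bool :=
  all (fun c => count (fun p => p.1 && (p.2 == c)) (zip r l) == 1)
    [:: inZp 0; inZp 1; inZp 2].

(** The 90 colorings of six positions whose color classes are three pairs. *)
Definition pair_colorings : seq (seq 'Z_3) :=
  permutations [:: inZp 0; inZp 0; inZp 1; inZp 1; inZp 2; inZp 2].

Definition balanced_matrix (rows : seq (seq bool)) : bool :=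
  has (fun l => all (balanced_row^~ l) rows) pair_colorings.

(* [if] rather than [==>]: the latter would make [vm_compute] evaluate
   [balanced_matrix] on all 2^15 matrices. *)
Definition cubic_implies_balanced (rows : seq (seq bool)) : bool :=
  if all (fun r => count id r == 3) rows then balanced_matrix rows else true.

Fixpoint all_bitseq (n : nat) (P : pred bitseq) : bool :=
  if n is n'.+1 then
    all_bitseq n' (fun s => P (true :: s)) &&
    all_bitseq n' (fun s => P (false :: s))
  else P [::].

Lemma all_bitseqP n P : all_bitseq n P -> forall s, size s = n -> P s.
Proof.
elim: n P => [|n IHn] P /=; first by move=> P0 [].
by case/andP=> Pt Pf [|[] s] //= [] sz; [apply: (IHn _ Pt)|apply: (IHn _ Pf)].
Qed.

(** The 15 bits fill the strict upper triangle row by row; irreflexivity and symmetry force the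
    rest. *)
Definition adjacency_matrix (s : bitseq) : seq (seq bool) :=
  if s is [:: b01; b02; b03; b04; b05; b12; b13; b14; b15;
              b23; b24; b25; b34; b35; b45] then
    [:: [:: false; b01; b02; b03; b04; b05];
        [:: b01; false; b12; b13; b14; b15];
        [:: b02; b12; false; b23; b24; b25];
        [:: b03; b13; b23; false; b34; b35];
        [:: b04; b14; b24; b34; false; b45];
        [:: b05; b15; b25; b35; b45; false]]
  else [::].

Lemma cubic_matrix_balanced s :
  size s = 15 -> cubic_implies_balanced (adjacency_matrix s).
Proof.
have all15 : all_bitseq 15 (fun s => cubic_implies_balanced (adjacency_matrix s)).
  by vm_compute.
exact: (all_bitseqP all15).
Qed.

Lemma three_balanced_of_single (G : sgraph) (l : G -> 'Z_3) :
  (forall v c, #|[set w in open_nbhd v | l w == c]| = 1) -> three_balanced G.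
Proof. by move=> l1; exists l => v c d; rewrite !l1. Qed.

Lemma card_set_count (T : finType) (P : pred T) :
  #|[set x | P x]| = count P (enum T).
Proof. by rewrite cardsE cardE -size_filter enumT. Qed.

Lemma adj_rows_balanced (G : sgraph) :
  cubic G -> #|G| = 6 ->
  balanced_matrix [seq [seq adj v w | w <- enum G] | v <- enum G].
Proof.
move=> cubG card6; set rows := map _ _.
have [t size_t rowsE] : exists2 t, size t = 15 & rows = adjacency_matrix t.
  move: card6; rewrite cardT {}/rows.
  case: (enum G) => [|v0 [|v1 [|v2 [|v3 [|v4 [|v5 []]]]]]] //= _.
  exists [:: adj v0 v1; adj v0 v2; adj v0 v3; adj v0 v4; adj v0 v5;
             adj v1 v2; adj v1 v3; adj v1 v4; adj v1 v5; adj v2 v3;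
             adj v2 v4; adj v2 v5; adj v3 v4; adj v3 v5; adj v4 v5] => //=.
  rewrite !adj_irrefl (adj_sym v1 v0) !(adj_sym v2 v0, adj_sym v2 v1).
  rewrite !(adj_sym v3 v0, adj_sym v3 v1, adj_sym v3 v2).
  rewrite !(adj_sym v4 v0, adj_sym v4 v1, adj_sym v4 v2, adj_sym v4 v3).
  rewrite (adj_sym v5 v0) (adj_sym v5 v1) (adj_sym v5 v2) (adj_sym v5 v3).
  by rewrite (adj_sym v5 v4).
have := cubic_matrix_balanced size_t; rewrite -rowsE /cubic_implies_balanced.
suff -> : all (fun r => count id r == 3) rows by [].
rewrite all_map; apply/allP => v _ /=.
by rewrite count_map -(cubG v) card_set_count.
Qed.

Lemma cubic6_three_balanced (G : sgraph) :
  cubic G -> #|G| = 6 -> three_balanced G.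
Proof.
move=> cubG card6; have /hasP[l l_col] := adj_rows_balanced cubG card6.
rewrite all_map => /allP l_bal.
have size_l : size l = size (enum G).
  by rewrite -cardT card6; move: l_col; rewrite mem_permutations => /perm_size.
(* [l] colors positions in [enum G]; [f] carries it over to vertices. By [size_l] the default color
   is never reached. *)
pose f w := nth (inZp 0) l (index w (enum G)).
have fE : map f (enum G) = l.
  apply: (@eq_from_nth _ (inZp 0)) => [|i]; rewrite size_map // => lti.
  have [v0 _] : exists v0 : G, v0 \in enum G.
    by case: (enum G) lti => [|v0 r] // _; exists v0; rewrite mem_head.
  by rewrite (nth_map v0) // /f index_uniq ?enum_uniq.
apply: (@three_balanced_of_single G f) => v c.
have := l_bal v (mem_enum _ v); rewrite /= /balanced_row -fE zip_map => /allP.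
have c_in : c \in [:: inZp 0; inZp 1; inZp 2 : 'Z_3].
  by case: c => [[|[|[|]]]].
move/(_ c c_in)/eqP; rewrite count_map card_set_count => f1.
by apply: etrans f1; apply: eq_count => w /=; rewrite inE.
Qed.

Theorem theorem8p1 :
  three_balanced (complete_bipartite 3 3) /\
  three_balanced triangular_prism /\
  (forall G : sgraph,
     connected_graph G -> cubic G -> #|G| = 6 -> three_balanced G).
Proof.
(* ['Z_3] unfolds to ['I_3], so the index of a vertex serves as its color. *)
pose l (u : 'I_3 + 'I_3) : 'Z_3 := match u with inl i | inr i => i end.
split; [|split].
- apply: (@three_balanced_of_single (complete_bipartite 3 3) l) => v c.
  (* The only neighbor colored [c] has index [c] on the opposite side. *)
  apply/eqP/cards1P; exists (if v is inl _ then inr c else inl c).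
  by apply/setP => w; rewrite !inE; case: v w => i [] j.
- apply: (@three_balanced_of_single triangular_prism l) => v c.
  (* The only neighbor colored [c] is the partner of [v] in the other triangle if [v] itself has
     color [c], and otherwise lies in the triangle of [v]. *)
  apply/eqP/cards1P; exists (match v with
    | inl i => if i == c then inr c else inl c
    | inr i => if i == c then inl c else inr c end).
  apply/setP => w; rewrite !inE.
  by case: c v w => [[|[|[|]]] ?] // [] [[|[|[|]]] ?] // [] [[|[|[|]]] ?].
- by move=> G _; apply: cubic6_three_balanced.
Qed.
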